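(* Let $n\ge1$, let \[ a(t)=\sum_{k=-n}^n a_kt^k=a_0+\sum_{k=1}^n a_k(t^k+t^{-k}) \] be a Laurent polynomial with complex coefficients such that $a_n\ne0$ and $a_k=a_{-k}$ for all $k$, and let $z_1,\ldots,z_n$ be the zeros (with multiplicity) of the polynomial $g$ of degree $n$ satisfying $a(t)=g(t+t^{-1})$, that is, \[ g(u)=a_0+\sum_{k=1}^n a_k\,2\mathcal{T}_k(u/2)=a_n\prod_{j=1}^n(u-z_j). \] Let $m\ge1$ and $0\le r\le m$ be integers, and let $\rho_1<\dots<\rho_r$ and $\sigma_1<\dots<\sigma_r$ be elements of $\{1,\ldots,m\}$. Put $d=m-r$ and let $\xi_1<\dots<\xi_d$ and $\eta_1<\dots<\eta_d$ be the elements of $\{1,\ldots,m\}\setminus\{\rho_1,\ldots,\rho_r\}$ and of $\{1,\ldots,m\}\setminus\{\sigma_1,\ldots,\sigma_r\}$, respectively. Then \begin{align*} \det T_m(a)_{\rho,\sigma}&=(-1)^{rn+|\rho|+|\sigma|}\,a_n^r\;\mathrm{sz}_{(r^n,\,\mathrm{rev}(\xi-\mathrm{id}_d))/(\mathrm{rev}(\eta-\mathrm{id}_d))}(z_1,\ldots,z_n),\\ \det T_m(a)_{\rho,\sigma}&=(-1)^{rn+|\rho|+|\sigma|}\,a_n^r\;\mathrm{sz}_{(r^n,\,r^d+\mathrm{id}_d-\eta)/(r^d+\mathrm{id}_d-\xi)}(z_1,\ldots,z_n). \end{align*}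
   Context: $T_m(a)=[a_{j-k}]_{j,k=1}^m$ is the $m\times m$ Toeplitz matrix generated by $a$, with $a_k=0$ for $|k|>n$; $T_m(a)_{\rho,\sigma}$ is its submatrix with rows $\rho_1,\ldots,\rho_r$ and columns $\sigma_1,\ldots,\sigma_r$. $|\rho|=\rho_1+\dots+\rho_r$, $|\sigma|=\sigma_1+\dots+\sigma_r$. $\mathrm{id}_d=(1,\ldots,d)$, $\mathrm{rev}(\alpha_1,\ldots,\alpha_d)=(\alpha_d,\ldots,\alpha_1)$; $p^q$ in a list means $p$ repeated $q$ times; sums and differences of lists are componentwise and $(r^n,\beta)$ means concatenation. $\mathcal{T}_k$ are the Chebyshev polynomials of the first kind. $\mathrm{s}_{\lambda/\mu}=\det[\mathrm{h}_{\lambda_j-\mu_k-j+k}]_{j,k=1}^{\ell(\lambda)}$ is the skew Schur function ($\mathrm{h}_k$ complete homogeneous, $\mathrm{h}_0=1$, $\mathrm{h}_k=0$ for $k<0$), with the usual convention $\mathrm{s}_{\lambda/\mu}=0$ if $\mu_i>\lambda_i$ for some $i$. $\mathrm{sz}_{\lambda/\mu}(z_1,\ldots,z_n)$ is the unique symmetric polynomial in $n$ variables over $\mathbb{C}$ such that $\mathrm{sz}_{\lambda/\mu}(x_1+x_1^{-1},\ldots,x_n+x_n^{-1})=\mathrm{s}_{\lambda/\mu}(x_1,\ldots,x_n,x_1^{-1},\ldots,x_n^{-1})$. *)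

(* Defs.v *)
From mathcomp Require Import all_boot all_order all_algebra.
From mathcomp Require Import ring.
From mathcomp Require Import boolp classical_sets reals.
From mathcomp Require Import complex.
From mathcomp Require Import mpoly.

Set Implicit Arguments.
Unset Strict Implicit.
Unset Printing Implicit Defensive.

Import Order.TTheory GRing.Theory Num.Theory.

Local Open Scope ring_scope.

(* The Laurent polynomial a(t) = \sum_(-n <= k <= n) a_k t^k is given by its
   coefficient function a : int -> C. *)

Definition toeplitz (R : comNzRingType) (a : int -> R) (m : nat) : 'M[R]_m :=
  \matrix_(j < m, k < m) a (j%:Z - k%:Z).

Fixpoint chebyshevT (R : comNzRingType) (k : nat) : {poly R} :=
  if k is k1.+1 then
    if k1 is k2.+1 then 2%:R *: ('X * chebyshevT R k1) - chebyshevT R k2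
    else 'X
  else 1.

Definition cheb_poly (F : fieldType) (a : int -> F) (n : nat) : {poly F} :=
  (a 0)%:P
  + \sum_(1 <= k < n.+1)
       a k%:Z *: (2%:R *: (chebyshevT F k \Po (2%:R^-1 *: 'X))).

Lemma chebyshevT_half (F : numFieldType) (t : F) (k : nat) :
  t != 0 -> 2%:R * (chebyshevT F k).[2%:R^-1 * (t + t^-1)] = t ^+ k + t ^- k.
Proof.
move=> t0.
suff: 2%:R * (chebyshevT F k).[2%:R^-1 * (t + t^-1)] = t ^+ k + t ^- k /\
      2%:R * (chebyshevT F k.+1).[2%:R^-1 * (t + t^-1)]
        = t ^+ k.+1 + t ^- k.+1 by case.
elim: k => [|k [IH1 IH2]].
  split; first by rewrite /= hornerC !expr0 invr1 mulr1.
  by rewrite /= hornerX !expr1 mulrA divff ?mul1r // pnatr_eq0.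
split => //.
have -> : chebyshevT F k.+2
    = 2%:R *: ('X * chebyshevT F k.+1) - chebyshevT F k by [].
rewrite hornerD hornerN hornerZ hornerM hornerX mulrBr IH1.
have -> : 2%:R * (2%:R * (2%:R^-1 * (t + t^-1)
      * (chebyshevT F k.+1).[2%:R^-1 * (t + t^-1)]))
    = (t + t^-1) * (2%:R * (chebyshevT F k.+1).[2%:R^-1 * (t + t^-1)]).
  by field.
rewrite IH2 !exprS; field.
by rewrite t0 expf_neq0.
Qed.

(* cheb_poly a n is the polynomial g with a(t) = g(t + 1/t). *)
Lemma cheb_polyE (F : numFieldType) (a : int -> F) (n : nat) (t : F) :
    (forall k : int, a (- k) = a k) -> t != 0 ->
  (cheb_poly a n).[t + t^-1]
    = a 0 + \sum_(1 <= k < n.+1) (a k%:Z * t ^+ k + a (- k%:Z) * t ^- k).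
Proof.
move=> asym t0; rewrite /cheb_poly hornerD hornerC horner_sum; congr (_ + _).
apply: eq_bigr => k _.
by rewrite !hornerZ horner_comp hornerZ hornerX chebyshevT_half // asym mulrDr.
Qed.

(* Index lists in the 1-based convention: f : 'I_r -> 'I_m stands for the list
   of the numbers (f j).+1 in {1, ..., m}. *)
Definition idx_list (m r : nat) (f : 'I_r -> 'I_m) : seq nat :=
  [seq (f j : nat).+1 | j <- enum 'I_r].

(* The elements of {1, ..., m} not in s, in increasing order. *)
Definition idx_compl (m : nat) (s : seq nat) : seq nat :=
  [seq k <- iota 1 m | k \notin s].

Definition idl (d : nat) : seq nat := iota 1 d.

Definition addl (s t : seq nat) : seq nat :=
  [seq (p.1 + p.2)%N | p <- zip s t].

(* The subtraction is truncated; it is applied to xi - id_d and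
   r^d + id_d - xi with xi increasing in {1, ..., r + d}, where
   j <= xi_j <= r + j. *)
Definition subl (s t : seq nat) : seq nat :=
  [seq (p.1 - p.2)%N | p <- zip s t].

Definition complete_sym (N : nat) (R : comNzRingType) (k : int) :
    {mpoly R[N]} :=
  if k is Posz d then \sum_(u : 'X_{1..N < d.+1} | mdeg u == d) 'X_[u] else 0.

(* Partitions are lists of natural numbers up to trailing zeros: the parts are
   read with nth 0, and the length is the number of nonzero parts. *)
Definition part_length (lam : seq nat) : nat := count (leq 1) lam.

Definition skew_schur (N : nat) (R : comNzRingType) (lam mu : seq nat) :
    {mpoly R[N]} :=
  if all (fun i => nth 0 mu i <= nth 0 lam i)%N (iota 0 (size mu)) then
    \det (\matrix_(j < part_length lam, k < part_length lam)
            complete_sym N R ((nth 0 lam j)%:Z - (nth 0 mu k)%:Z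
                              - j%:Z + k%:Z))
  else 0.

(* (x_1, ..., x_n, 1/x_1, ..., 1/x_n) *)
Definition with_inverses (F : fieldType) (n : nat) (x : 'I_n -> F) :
    'I_(n + n) -> F :=
  fun i => match fintype.split i with inl j => x j | inr j => (x j)^-1 end.

Definition is_sz (F : fieldType) (n : nat) (lam mu : seq nat)
    (p : {mpoly F[n]}) : Prop :=
  p \is symmetric /\
  forall x : 'I_n -> F, (forall i, x i != 0) ->
    p.@[fun i => x i + (x i)^-1]
      = (skew_schur (n + n) F lam mu).@[with_inverses x].

(* The polynomial characterized by is_sz (0 if there were none). *)
Definition sz (F : fieldType) (n : nat) (lam mu : seq nat) : {mpoly F[n]} :=
  xget 0 [set p : {mpoly F[n]} | is_sz lam mu p]%classic.

(* Main.v *)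
Require Import Defs.
From mathcomp Require Import all_boot all_order all_algebra.
From mathcomp Require Import zify ring.
From mathcomp Require Import classical_sets reals.
From mathcomp Require Import complex.
From mathcomp Require Import mpoly.

Set Implicit Arguments.
Unset Strict Implicit.
Unset Printing Implicit Defensive.

Import Order.TTheory GRing.Theory Num.Theory.

Local Open Scope ring_scope.

(** Write g(u) = a_n \prod_j (u - z_j), so that
    t^n a(t) = a_n E(t) with E(t) = \prod_j (1 - z_j t + t^2).  The entry
    a_(j-k) is then a_n times the coefficient of index n + k - j of E, hence
    T_m(a) is, up to the factor a_n, the block of rows 0..m-1 and columns
    n..m+n-1 of the upper triangular Toeplitz matrix U of size m + n generated
    by E.  A minor of T_m(a) with rows rho and columns sigma is thus a_n^r
    times the minor of U with rows rho and columns n + sigma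
    (here and below, positions are counted from 0).

    The matrix U has determinant 1 and its inverse V is the Toeplitz matrix
    generated by H = 1/E.  Jacobi's identity for complementary minors
    ([jacobi_complementary_minor]) turns the minor of U into a signed minor of
    V, whose rows are 0..n-1 followed by n + eta and whose columns are xi
    followed by m..m+n-1.  Every entry of this minor is a coefficient of H or 0.

    Substituting z_j = x_j + 1/x_j factors E as
    \prod_j (1 - x_j t)(1 - t/x_j), so the coefficients of H are the complete
    homogeneous polynomials in the x_j and the 1/x_j
    ([meval_complete_sym], [with_inverses_prod]).  Consequently the
    Jacobi-Trudi determinant written with the coefficients of 1/E, where the
    z_j are kept as indeterminates, is a symmetric polynomial with the property
    that characterizes sz ([is_sz_sz_poly]).  As every complex number has the
    form x + 1/x with x nonzero, the value of sz at z is this determinant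
    ([meval_sz]).

    It remains to recognize the minor of V as the Jacobi-Trudi determinant of
    the stated skew shapes.  A strictly increasing list of positions encodes a
    partition, either by subtracting the positions from a constant or by
    reading them backwards; the first reading gives the second formula, and
    the second one, combined with a reflection of the matrix in its
    antidiagonal, gives the first formula
    ([jt_det_second], [jt_det_first]). *)

(** * Inverse power series *)

(** The coefficient of index k of the power series 1/p, for p with constant term
    1: the geometric series of 1 - p, cut where its terms stop contributing. *)
Definition inv_coef (R : comNzRingType) (p : {poly R}) (k : nat) : R :=
  (\sum_(i < k.+1) (1 - p) ^+ i)`_k.

(** Congruence to 1 modulo the K-th power of the variable. *)
Definition eq1_mod (R : comNzRingType) (K : nat) (p : {poly R}) : Prop :=
  exists q : {poly R}, p = 1 + 'X^K * q.

Lemma eq1_mod1 (R : comNzRingType) (K : nat) : eq1_mod K (1 : {poly R}).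
Proof. by exists 0; rewrite mulr0 addr0. Qed.

Lemma eq1_modM (R : comNzRingType) (K : nat) (p q : {poly R}) :
  eq1_mod K p -> eq1_mod K q -> eq1_mod K (p * q).
Proof.
move=> [u ->] [v ->]; exists (u + v + 'X^K * u * v); ring.
Qed.

Lemma coef_eq1_mod (R : comNzRingType) (K k : nat) (p : {poly R}) :
  eq1_mod K p -> (k < K)%N -> p`_k = (k == 0)%:R.
Proof. by move=> [u ->] kK; rewrite coefD coef1 coefXnM kK addr0. Qed.

Lemma coef0_eq_mulX (R : comNzRingType) (w : {poly R}) :
  w`_0 = 0 -> exists v, w = 'X * v.
Proof.
move=> w0; exists (drop_poly 1 w); rewrite mulrC -[LHS](poly_take_drop 1).
suff -> : take_poly 1 w = 0 by rewrite add0r.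
by apply/polyP=> -[|i]; rewrite coef_take_poly coef0 //= w0.
Qed.

Lemma eq1_mod_geom (R : comNzRingType) (w : {poly R}) (K : nat) :
  w`_0 = 0 -> eq1_mod K ((1 - w) * \sum_(i < K) w ^+ i).
Proof.
move=> /coef0_eq_mulX [v ->]; exists (- v ^+ K).
have := subrX1 ('X * v) K; rewrite exprMn => E.
have -> : 1 - 'X * v = - ('X * v - 1) by ring.
by rewrite mulNr -E; ring.
Qed.

(** Powers of a series without constant term have no coefficients below the
    exponent, so longer partial sums agree with shorter ones. *)
Lemma coef_geom_stable (R : comNzRingType) (w : {poly R}) (k K : nat) :
  w`_0 = 0 -> (k < K)%N ->
  (\sum_(i < K) w ^+ i)`_k = (\sum_(i < k.+1) w ^+ i)`_k.
Proof.
move=> /coef0_eq_mulX [v ->] kK; rewrite !coef_sum.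
rewrite -(big_mkord xpredT (fun i => (('X * v) ^+ i)`_k)).
rewrite (big_cat_nat _ kK) //= big_mkord.
rewrite [X in _ + X]big_nat_cond [X in _ + X]big1 ?addr0 // => i.
by rewrite andbT => /andP[ki _]; rewrite exprMn coefXnM ki.
Qed.

Lemma inv_coef_conv (R : comNzRingType) (p : {poly R}) (k : nat) :
  p`_0 = 1 -> \sum_(i < k.+1) p`_i * inv_coef p (k - i) = (k == 0)%:R.
Proof.
move=> p0; have w0 : (1 - p)`_0 = 0 by rewrite coefB coef1 p0 subrr.
rewrite -(coef_eq1_mod (eq1_mod_geom k.+1 w0) (ltnSn k)) coefM.
rewrite subKr; apply: eq_bigr => i _; congr (_ * _).
by rewrite coef_geom_stable // ltnS leq_subr.
Qed.

(** Two inverses q and s of p modulo X^K agree there, since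
    q = q (p s) = s (p q). This identifies explicit generating functions with
    the inverse series. *)
Lemma inv_coef_unique (R : comNzRingType) (p q : {poly R}) (K k : nat) :
  p`_0 = 1 -> eq1_mod K (p * q) -> (k < K)%N -> q`_k = inv_coef p k.
Proof.
move=> p0 pq kK; have w0 : (1 - p)`_0 = 0 by rewrite coefB coef1 p0 subrr.
set s := \sum_(i < K) (1 - p) ^+ i.
have ps : eq1_mod K (p * s).
  by have := eq1_mod_geom K w0; rewrite subKr.
rewrite /inv_coef -(coef_geom_stable w0 kK) -/s.
case: pq => u Eu; case: ps => v Ev.
have: q * (p * s) = s * (p * q) by ring.
rewrite Eu Ev => /(congr1 (fun f : {poly R} => f`_k)).
by rewrite !mulrDr !mulr1 !coefD ![_ * ('X^K * _)]mulrCA !coefXnM kK !addr0.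
Qed.

Lemma inv_coef0 (R : comNzRingType) (p : {poly R}) : inv_coef p 0 = 1.
Proof. by rewrite /inv_coef big_ord1 expr0 coef1. Qed.

Lemma rmorph_inv_coef (R S : comNzRingType) (f : {rmorphism R -> S})
  (p : {poly R}) (k : nat) : f (inv_coef p k) = inv_coef (map_poly f p) k.
Proof.
rewrite /inv_coef -coef_map /= rmorph_sum !coef_sum.
by apply: eq_bigr => i _; rewrite /= rmorphXn rmorphB rmorph1.
Qed.

Definition zext (R : nmodType) (c : nat -> R) (k : int) : R :=
  if k is Posz d then c d else 0.

Lemma zext_neg (R : nmodType) (c : nat -> R) (k : int) : k < 0 -> zext c k = 0.
Proof. by case: k. Qed.

Lemma zext_nat (R : nmodType) (c : nat -> R) (j i : nat) : (i <= j)%N ->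
  zext c (j%:Z - i%:Z) = c (j - i)%N.
Proof. by move=> ij; rewrite subzn. Qed.

(** Upper triangular Toeplitz matrices multiply like truncated power series:
    between x and y the product is the convolution of p with 1/p. *)
Lemma toeplitz_inv (R : comNzRingType) (p : {poly R}) (M x y : nat) :
  p`_0 = 1 -> (x < M)%N -> (y < M)%N ->
  \sum_(k < M) zext (nth 0 p) (k%:Z - x%:Z) * zext (inv_coef p) (y%:Z - k%:Z)
    = (x == y)%:R.
Proof.
move=> p0 xM yM.
pose F k := zext (nth 0 p) (k%:Z - x%:Z) * zext (inv_coef p) (y%:Z - k%:Z).
rewrite -(big_mkord xpredT F).
have F0 k : (k < x)%N || (y < k)%N -> F k = 0.
  rewrite /F; case/orP=> h; last by rewrite [X in _ * X]zext_neg ?mulr0 //; lia.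
  by rewrite zext_neg ?mul0r //; lia.
have [xy|yx] := leqP x y; last first.
  rewrite big1_seq; last by move=> k _; apply: F0; lia.
  by rewrite gtn_eqF.
rewrite (big_cat_nat (n := x)) //=; last by lia.
rewrite (big_cat_nat (n := y.+1) (m := x)) //=; last by lia.
rewrite [X in X + _]big1_seq ?add0r; last first.
  by move=> k; rewrite mem_index_iota => h; apply: F0; lia.
rewrite [X in _ + X]big1_seq ?addr0; last first.
  by move=> k; rewrite mem_index_iota => h; apply: F0; lia.
rewrite -{1}[x]add0n big_addn subSn // big_mkord.
have -> : (x == y) = (y - x == 0)%N by lia.
rewrite -(inv_coef_conv (y - x) p0); apply: eq_bigr => i _.
have i_le : (i <= y - x)%N by rewrite -ltnS.
by rewrite /F !zext_nat; [congr (_`_ _ * inv_coef _ _); lia | lia | lia].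
Qed.

(** * Complementary minors *)

Lemma sum_delta_nat (R : pzSemiRingType) (M x : nat) (f : nat -> R) :
  (x < M)%N -> \sum_(k < M) (x == k)%:R * f k = f x.
Proof.
move=> xM; rewrite (bigD1 (Ordinal xM)) //= eqxx mul1r big1 ?addr0 // => k.
by rewrite -val_eqE /= eq_sym => /negPf ->; rewrite mul0r.
Qed.

(** Pigeonhole: distinct numbers below M fill the range once there are M of
    them. *)
Lemma perm_iota_eq (s : seq nat) (M : nat) :
  uniq s -> all (fun i => i < M)%N s -> size s = M -> perm_eq s (iota 0 M).
Proof.
move=> us /allP sM ss; apply: uniq_perm => //; first exact: iota_uniq.
have sub : {subset s <= iota 0 M} by move=> i /sM; rewrite mem_iota.
by case: (uniq_min_size us sub) => //; rewrite size_iota ss.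
Qed.

Lemma nth_perm_iota (s : seq nat) (M i : nat) :
  perm_eq s (iota 0 M) -> (i < M)%N -> (nth 0 s i < M)%N.
Proof.
move=> sM iM; have : nth 0%N s i \in iota 0 M.
  by rewrite -(perm_mem sM) mem_nth // (perm_size sM) size_iota.
by rewrite mem_iota.
Qed.

Lemma nth_sorted_ltn (s : seq nat) (i j : nat) :
  sorted ltn s -> (i < j)%N -> (j < size s)%N -> (nth 0 s i < nth 0 s j)%N.
Proof.
by move=> ss ij js; apply: (sorted_ltn_nth ltn_trans) => //;
  rewrite inE // (ltn_trans ij).
Qed.

(** The sign of a shuffle permutation, as the determinant of its matrix.
    Expanding along the first row removes the first letter x with the sign
    (-1)^x and lowers by one the letters above x; these include all the letters
    that remain in the increasing word u, which is why u decides the sign. *)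
Lemma det_shuffle (R : comNzRingType) (u v : seq nat) (M : nat) :
  sorted ltn u -> sorted ltn v -> perm_eq (u ++ v) (iota 0 M) ->
  \det (\matrix_(i < M, j < M) (nth 0%N (u ++ v) i == j)%:R : 'M[R]_M)
    = (-1) ^+ (sumn u + 'C(size u, 2)).
Proof.
move eqk: (size u) => k.
elim: k u v M eqk => [|k IH] [|x u] v M // eqk su sv pM.
  have -> : v = iota 0 M.
    by apply: (irr_sorted_eq ltn_trans ltnn) => //;
      [exact: iota_ltn_sorted | exact: perm_mem].
  rewrite expr0 -[RHS](det1 R M); congr determinant; apply/matrixP => i j.
  by rewrite !mxE /= nth_iota // add0n val_eqE.
case: M pM => [|M] pM; first by have := perm_size pM.
have xM : (x < M.+1)%N by apply: (nth_perm_iota (i := 0) pM).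
have un : uniq (x :: u ++ v) by rewrite (perm_uniq pM) iota_uniq.
have nx y : y \in u ++ v -> y != x.
  by move=> yin; apply: contraTneq yin => ->; case/andP: un.
have lM y : y \in u ++ v -> (y < M.+1)%N.
  by move=> yin; have := perm_mem pM y; rewrite mem_iota inE yin orbT add0n.
have sz : size (u ++ v) = M by move: (perm_size pM); rewrite size_iota => -[].
have hom w : {subset w <= u ++ v} -> sorted ltn w ->
    sorted ltn (map (unbump x) w).
  move=> sw; apply: (@homo_sorted_in _ _ (mem w) _ ltn ltn); last exact/allP.
  by move=> y z /sw /nx yx /sw /nx zx; rewrite /unbump; lia.
have subu : {subset u <= u ++ v} by move=> y yu; rewrite mem_cat yu.
have subv : {subset v <= u ++ v} by move=> y yu; rewrite mem_cat yu orbT.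
have su' := path_sorted su.
have pM' : perm_eq (map (unbump x) u ++ map (unbump x) v) (iota 0 M).
  rewrite -map_cat; apply: perm_iota_eq; last by rewrite size_map.
    rewrite map_inj_in_uniq; first by move: un => /= /andP[].
    by move=> y z /nx yx /nx zx; rewrite /unbump; lia.
  apply/allP => _ /mapP[y yin ->]; have := nx _ yin; have := lM _ yin.
  by rewrite /unbump; lia.
have {IH} IHM := IH _ _ _ (etrans (size_map _ _) (eq_add_S _ _ eqk)) (hom _ subu su') (hom _ subv sv) pM'.
rewrite (expand_det_row _ ord0).
under eq_bigr => j _ do rewrite mxE /=.
rewrite (bigD1 (Ordinal xM)) //= eqxx mul1r big1 ?addr0; last first.
  by move=> j; rewrite -val_eqE /= eq_sym => /negPf ->; rewrite mul0r.
rewrite /cofactor [X in \det X](_ : _ =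
   \matrix_(i < M, j < M)
     (nth 0%N (map (unbump x) u ++ map (unbump x) v) i == j)%:R); last first.
  apply/matrixP => i j; rewrite !mxE -map_cat /= /bump /= add0n.
  rewrite (nth_map 0%N) ?sz //.
  have := nx (nth 0%N (u ++ v) i); rewrite mem_nth ?sz // => /(_ isT) yx.
  by congr (_%:R); congr nat_of_bool; rewrite /unbump /bump; lia.
rewrite IHM.
have sumE : (sumn (map (unbump x) u) + size u = sumn u)%N.
  have: all (ltn x) u by apply: order_path_min su; exact: ltn_trans.
  elim: (u) => //= y w IHw /andP[xy /IHw]; rewrite /unbump; lia.
move: sumE eqk; rewrite /= => sumE [eqk].
(* The lowering changes the sum by size u, and so does the step of the
   binomial coefficient: the parities cancel. *)
rewrite -exprD /= add0n binS bin1 -signr_odd -[RHS]signr_odd.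
congr (_ ^+ _); congr nat_of_bool; rewrite -sumE; lia.
Qed.

(** Reordering rows and columns by the two words makes both minors corner
    blocks. If U' and V' are the reordered matrices, then U' V' = 1, and
    replacing the left block column of V' by that of the identity gives
    U' [1, V'_12; 0, V'_22] = [U'_11, 0; U'_21, 1].
    Taking determinants yields the identity up to det U', which is the product
    of the two shuffle signs. *)
Lemma jacobi_complementary_minor (R : comNzRingType) (U V : nat -> nat -> R)
    (r s : nat) (F1 F2 G1 G2 : seq nat) :
  size F1 = r -> size G1 = r -> 
  sorted ltn F1 -> sorted ltn F2 -> sorted ltn G1 -> sorted ltn G2 ->
  perm_eq (F1 ++ F2) (iota 0 (r + s)) -> perm_eq (G1 ++ G2) (iota 0 (r + s)) ->
  (forall x y, (x < r + s)%N -> (y < r + s)%N ->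
     \sum_(k < r + s) U x k * V k y = (x == y)%:R) ->
  \det (\matrix_(i < r + s, j < r + s) U i j) = 1 ->
  \det (\matrix_(i < r, j < r) U (nth 0%N F1 i) (nth 0%N G1 j))
    = (-1) ^+ (sumn F1 + sumn G1) *
      \det (\matrix_(i < s, j < s) V (nth 0%N G2 i) (nth 0%N F2 j)).
Proof.
move=> sF sG oF1 oF2 oG1 oG2 pF pG UV detU.
set F := F1 ++ F2 in pF; set G := G1 ++ G2 in pG.
pose U' : 'M_(r + s) := \matrix_(i, j) U (nth 0%N F i) (nth 0%N G j).
pose V' : 'M_(r + s) := \matrix_(i, j) V (nth 0%N G i) (nth 0%N F j).
have szF : size F = (r + s)%N by rewrite (perm_size pF) size_iota.
have szG : size G = (r + s)%N by rewrite (perm_size pG) size_iota.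
have uF : uniq F by rewrite (perm_uniq pF) iota_uniq.
have UV1 : U' *m V' = 1%:M.
  apply/matrixP => i j; rewrite !mxE.
  under eq_bigr => k _ do rewrite !mxE.
  pose f x := U (nth 0%N F i) x * V x (nth 0%N F j).
  rewrite -(big_mkord xpredT (fun k => f (nth 0%N G k))).
  have -> : \sum_(0 <= k < r + s) f (nth 0%N G k) = \sum_(x <- G) f x.
    by rewrite [RHS](big_nth 0%N) szG.
  have -> : \sum_(x <- G) f x = \sum_(0 <= x < r + s) f x.
    by rewrite (perm_big _ pG) /index_iota subn0.
  rewrite big_mkord /f.
  rewrite UV ?nth_perm_iota //.
  by rewrite nth_uniq ?szF ?ltn_ord.
pose P (w : seq nat) : 'M[R]_(r + s) := \matrix_(i, j) (nth 0%N w i == j)%:R.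
have U'E : U' = P F *m (\matrix_(i, j) U i j) *m (P G)^T.
  apply/matrixP => i j; rewrite !mxE.
  under eq_bigr => k _.
    rewrite !mxE mulrC.
    under eq_bigr => l _ do rewrite !mxE.
    rewrite (sum_delta_nat (fun l => U l k)) ?nth_perm_iota //.
    over.
  by rewrite (sum_delta_nat (U (nth 0%N F i))) ?nth_perm_iota.
have detU' : \det U' = (-1) ^+ (sumn F1 + sumn G1).
  rewrite U'E !det_mulmx det_tr detU mulr1 !det_shuffle // sF sG -exprD.
  rewrite -[LHS]signr_odd -[RHS]signr_odd; congr (_ ^+ _); congr nat_of_bool; lia.
have blockE : U' *m block_mx 1%:M (ursubmx V') 0 (drsubmx V')
    = block_mx (ulsubmx U') 0 (dlsubmx U') 1%:M.
  have := UV1; rewrite -{1}[U']submxK -{1}[V']submxK mulmx_block.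
  rewrite scalar_mx_block => /eq_block_mx [_ E1 _ E2].
  by rewrite -{1}[U']submxK mulmx_block !mulmx1 !mulmx0 !addr0 E1 E2.
have ulE : ulsubmx U' = \matrix_(i, j) U (nth 0%N F1 i) (nth 0%N G1 j).
  by apply/matrixP => i j; rewrite !mxE /= /F /G !nth_cat sF sG !ltn_ord.
have drE : drsubmx V' = \matrix_(i, j) V (nth 0%N G2 i) (nth 0%N F2 j).
  apply/matrixP => i j; rewrite !mxE /= /F /G !nth_cat sF sG.
  by rewrite !ltnNge !leq_addr /= !addKn.
have := congr1 (fun A : 'M_(r + s) => \det A) blockE.
rewrite /= det_mulmx det_ublock det_lblock !det1 mul1r mulr1 ulE drE detU'.
by move=> <-.
Qed.

(** * Determinants with a triangular shape *)

(** A lower left zero block that touches the diagonal forces the determinant to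
    vanish: the leading block ending at position i has a zero last row. *)
Lemma det_lower_zero_block (R : comNzRingType) (L i : nat) (f : nat -> nat -> R) :
  (i < L)%N -> (forall j k, (i <= j)%N -> (k <= i)%N -> f j k = 0) ->
  \det (\matrix_(j < L, k < L) f j k) = 0.
Proof.
move=> iL f0; have [q ->] : exists q, L = (i.+1 + q)%N.
  by exists (L - i.+1)%N; lia.
set A := (X in \det X).
have dl0 : dlsubmx A = 0.
  by apply/matrixP => j k; rewrite !mxE /=; apply: f0; have := ltn_ord k; lia.
rewrite -[A]submxK dl0 det_ublock (expand_det_row _ ord_max) big1 ?mul0r //.
by move=> k _; rewrite !mxE /= f0 ?mul0r // -ltnS.
Qed.

Lemma det_lower_unitriangular (R : comNzRingType) (p L : nat)
    (f : nat -> nat -> R) :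
  (p <= L)%N ->
  (forall j k, (p <= j)%N -> (k <= j)%N -> f j k = (j == k)%:R) ->
  \det (\matrix_(j < L, k < L) f j k) = \det (\matrix_(j < p, k < p) f j k).
Proof.
move=> pL f0; have [q ->] : exists q, L = (p + q)%N by exists (L - p)%N; lia.
set A := (X in \det X = _).
have dl0 : dlsubmx A = 0.
  apply/matrixP => j k; have kp := ltn_ord k.
  by rewrite !mxE /= f0; [rewrite gtn_eqF // | |]; lia.
rewrite -[A]submxK dl0 det_ublock -[\det (drsubmx A)]det_tr.
rewrite [X in _ * X]det_trig; last first.
  apply/is_trig_mxP => j k jk.
  by rewrite !mxE /= f0; [rewrite gtn_eqF // | |]; lia.
rewrite [X in _ * X]big1 ?mulr1; last first.
  by move=> j _; rewrite !mxE /= f0 ?eqxx; [|lia|lia].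
by congr determinant; apply/matrixP => j k; rewrite !mxE.
Qed.

Lemma det_antitranspose (R : comNzRingType) (L : nat) (f : nat -> nat -> R) :
  \det (\matrix_(j < L, k < L) f (L - k.+1)%N (L - j.+1)%N)
    = \det (\matrix_(j < L, k < L) f j k).
Proof.
pose s : perm.perm_of 'I_L := perm.perm (@rev_ord_inj L).
rewrite -[RHS]det_tr.
have -> : \matrix_(j < L, k < L) f (L - k.+1)%N (L - j.+1)%N
   = row_perm s (col_perm s (\matrix_(j < L, k < L) f j k)^T).
  by apply/matrixP => j k; rewrite !mxE !perm.permE.
rewrite row_permE col_permE !det_mulmx !det_perm perm.odd_permV.
by rewrite mulrC -mulrA -signr_addb addbb mulr1.
Qed.

(** * Jacobi-Trudi determinants *)

(** The Jacobi-Trudi determinant with arbitrary coefficients in place of the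
    complete homogeneous polynomials, so that it can be evaluated and compared
    across rings. *)
Definition jt_det (R : comNzRingType) (c : int -> R) (lam mu : seq nat) : R :=
  if all (fun i => nth 0 mu i <= nth 0 lam i)%N (iota 0 (size mu)) then
    \det (\matrix_(j < part_length lam, k < part_length lam)
            c ((nth 0%N lam j)%:Z - (nth 0%N mu k)%:Z - j%:Z + k%:Z))
  else 0.

Lemma rmorph_jt_det (R S : comNzRingType) (f : {rmorphism R -> S})
    (c : int -> R) (lam mu : seq nat) :
  f (jt_det c lam mu) = jt_det (fun k => f (c k)) lam mu.
Proof.
rewrite /jt_det; case: ifP => _; last by rewrite rmorph0.
by rewrite -det_map_mx; congr determinant; apply/matrixP => j k; rewrite !mxE.
Qed.

Lemma eq_jt_det (R : comNzRingType) (c c' : int -> R) (lam mu : seq nat) :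
  c =1 c' -> jt_det c lam mu = jt_det c' lam mu.
Proof.
move=> cc'; rewrite /jt_det; case: ifP => // _.
by congr determinant; apply/matrixP => j k; rewrite !mxE cc'.
Qed.

Definition noninc (s : seq nat) : Prop :=
  forall i j, (i <= j)%N -> (nth 0 s j <= nth 0 s i)%N.

Lemma part_length_gt (s : seq nat) (j : nat) :
  noninc s -> (j < part_length s)%N = (0 < nth 0 s j)%N.
Proof.
rewrite /part_length; elim: s j => [|x s IH] j ns; first by rewrite nth_nil.
have ns' : noninc s by move=> i k ik; apply: (ns i.+1 k.+1).
case: j => [|j] /=.
  case: x ns => [|x] ns //=; rewrite add0n.
  have := IH 0%N ns'; have /= := ns 0%N 1%N isT.
  by rewrite leqn0 => /eqP ->.
case: x ns => [|x] ns /=; last by rewrite add1n ltnS IH.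
rewrite add0n -IH //; have := ns 0%N j.+1 isT; rewrite /= leqn0 => /eqP s0.
have : (j < count (leq 1) s)%N = false by rewrite IH // s0.
have : (0 < count (leq 1) s)%N = false.
  by rewrite IH //; have := ns 0%N 1%N isT; rewrite /= leqn0 => /eqP ->.
by lia.
Qed.

(** The determinant may be taken of any size L that bounds both lists, and the
    containment test may be dropped. The rows beyond the number of nonzero parts
    are unitriangular; when mu_i exceeds lam_i, monotonicity makes all entries
    on or below row i and on or left of column i have a negative index, and the
    determinant vanishes. *)
Lemma jt_det_full (R : comNzRingType) (c : int -> R) (lam mu : seq nat)
    (L : nat) :
  (forall k, k < 0 -> c k = 0) -> c 0 = 1 ->
  noninc lam -> noninc mu -> (size lam <= L)%N -> (size mu <= L)%N ->
  jt_det c lam mu = \det (\matrix_(j < L, k < L)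
     c ((nth 0%N lam j)%:Z - (nth 0%N mu k)%:Z - j%:Z + k%:Z)).
Proof.
move=> cneg c0 dlam dmu slam smu; rewrite /jt_det.
pose f (j k : nat) := c ((nth 0%N lam j)%:Z - (nth 0%N mu k)%:Z - j%:Z + k%:Z).
case: ifP => [/allP sub|/negbT nsub]; last first.
  move/allPn: nsub => [i ]; rewrite mem_iota /= add0n -ltnNge => imu lt.
  rewrite (det_lower_zero_block (i := i) (f := f)) //; first by lia.
  move=> j k ij ki; have := dlam _ _ ij; have := dmu _ _ ki.
  by move=> *; rewrite /f cneg //; lia.
rewrite [RHS](det_lower_unitriangular (p := part_length lam) (f := f)) //.
  exact: leq_trans (count_size _ _) slam.
move=> j k pj kj; have lam0 : nth 0%N lam j = 0%N.
  by apply/eqP; rewrite -leqn0 leqNgt -part_length_gt // -leqNgt.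
rewrite /f lam0; have [jk|jk] := eqVneq j k; last by rewrite cneg //; lia.
rewrite -jk; suff -> : nth 0%N mu j = 0%N by rewrite -c0; congr c; lia.
have [jmu|] := ltnP j (size mu); last by move/(nth_default 0%N).
by have := sub j; rewrite mem_iota lam0 leqn0 => /(_ jmu) /eqP.
Qed.

(** * The symmetric polynomials sz *)

(** The polynomial t^n a(t) / a_n in terms of the zeros w_j of g. *)
Definition quad_prod (R : comNzRingType) (n : nat) (w : 'I_n -> R) : {poly R} :=
  \prod_(j < n) (1 - w j *: 'X + 'X^2).

Lemma coef0_prod1 (R : comNzRingType) (I : finType) (p : I -> {poly R}) :
  (forall i, (p i)`_0 = 1) -> (\prod_i p i)`_0 = 1.
Proof.
move=> p1; rewrite -horner_coef0 horner_prod big1 // => i _.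
by rewrite horner_coef0.
Qed.

Lemma quad_prod_coef0 (R : comNzRingType) (n : nat) (w : 'I_n -> R) :
  (quad_prod w)`_0 = 1.
Proof.
apply: coef0_prod1 => i.
by rewrite coefD coefB coef1 coefZ coefX coefXn /= mulr0 subr0 addr0.
Qed.

Lemma map_quad_prod (R S : comNzRingType) (f : {rmorphism R -> S}) (n : nat)
    (w : 'I_n -> R) : map_poly f (quad_prod w) = quad_prod (fun j => f (w j)).
Proof.
rewrite /quad_prod rmorph_prod; apply: eq_bigr => j _ /=.
by rewrite rmorphD rmorphB rmorph1 /= map_polyZ map_polyX map_polyXn.
Qed.

Lemma linear_prod_coef0 (R : comNzRingType) (N : nat) (y : 'I_N -> R) :
  (\prod_i (1 - y i *: 'X))`_0 = 1.
Proof.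
apply: coef0_prod1 => i; by rewrite coefB coef1 coefZ coefX mulr0 subr0.
Qed.

(** The generating function of the complete homogeneous polynomials is
    \prod_i 1/(1 - y_i X). Truncating each geometric factor after degree k and
    distributing the product gives a sum over exponent vectors, whose
    coefficient of index k is the sum over the monomials of degree k. *)
Lemma meval_complete_sym (R : comNzRingType) (N k : nat) (y : 'I_N -> R) :
  (complete_sym N R k).@[y] = inv_coef (\prod_i (1 - y i *: 'X)) k.
Proof.
pose q : {poly R} := \prod_i \sum_(j < k.+1) (y i *: 'X) ^+ j.
rewrite -(@inv_coef_unique _ _ q k.+1) //; first last.
- rewrite -big_split /=; apply: big_ind; first exact: eq1_mod1.
    by move=> *; exact: eq1_modM.
  by move=> i _; apply: eq1_mod_geom; rewrite coefZ coefX mulr0.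
- exact: linear_prod_coef0.
rewrite /q bigA_distr_bigA /= coef_sum.
pose e (f : {ffun 'I_N -> 'I_k.+1}) := (\sum_i f i)%N.
have coefE (f : {ffun 'I_N -> 'I_k.+1}) :
    (\prod_i (y i *: 'X) ^+ f i)`_k
      = if e f == k then \prod_i y i ^+ f i else 0.
  under eq_bigr => i _ do rewrite exprZn -mul_polyC.
  rewrite big_split /= -rmorph_prod prodrXr coefCM coefXn eq_sym.
  by case: eqP; rewrite ?mulr1 ?mulr0.
rewrite [RHS](eq_bigr _ (fun f _ => coefE f)).
rewrite -big_mkcond /= raddf_sum /=.
have m0 : (mdeg (0%MM : 'X_{1.. N}) < k.+1)%N by rewrite mdeg0.
(* Monomials of degree k correspond to vectors of exponents at most k with
   sum k; outside this range h' takes an arbitrary value. *)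
pose h (u : 'X_{1.. N < k.+1}) : {ffun 'I_N -> 'I_k.+1} :=
  [ffun i => inord (bmnm u i)].
pose h' (f : {ffun 'I_N -> 'I_k.+1}) : 'X_{1.. N < k.+1} :=
  insubd (BMultinom m0) [multinom (f i : nat) | i < N].
have hE u i : h u i = bmnm u i :> nat.
  rewrite ffunE inordK // (leq_ltn_trans _ (valP u)) //= mdegE.
  by rewrite (bigD1 i) //= leq_addr.
have h'E f : e f = k -> bmnm (h' f) = [multinom (f i : nat) | i < N].
  move=> ef; rewrite /h' -[bmnm _]/(val _) insubdK // unfold_in mdegE.
  by under eq_bigr => i _ do rewrite mnmE; rewrite -[X in (X < _)%N]/(e f) ef ltnS.
rewrite [RHS](reindex_onto h h'); last first.
  by move=> f /eqP /h'E E; apply/ffunP => i; apply/val_inj; rewrite /= hE E mnmE.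
have eh u : e (h u) = mdeg (bmnm u).
  by rewrite mdegE; apply: eq_bigr => i _; rewrite hE.
apply: eq_big => [u|u _].
  rewrite eh; case: eqP => //= du; apply/esym/eqP/val_inj; rewrite /= h'E ?eh //.
  by apply/mnmP => i; rewrite mnmE hE.
by rewrite mevalX; apply: eq_bigr => i _; rewrite hE.
Qed.

Lemma skew_schur_jt (R : comNzRingType) (N : nat) (lam mu : seq nat) :
  skew_schur N R lam mu = jt_det (complete_sym N R) lam mu.
Proof. by []. Qed.

Lemma meval_skew_schur (R : comNzRingType) (N : nat) (lam mu : seq nat)
    (y : 'I_N -> R) :
  (skew_schur N R lam mu).@[y]
    = jt_det (zext (inv_coef (\prod_i (1 - y i *: 'X)))) lam mu.
Proof.
rewrite skew_schur_jt rmorph_jt_det; apply: eq_jt_det => -[k|k] /=.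
  exact: meval_complete_sym.
exact: meval0.
Qed.

Lemma rmorph_zext_inv (R S : comNzRingType) (f : {rmorphism R -> S})
    (p : {poly R}) (k : int) :
  f (zext (inv_coef p) k) = zext (inv_coef (map_poly f p)) k.
Proof. by case: k => [k|k] /=; rewrite ?rmorph0 ?rmorph_inv_coef. Qed.

Lemma with_inverses_prod (F : fieldType) (n : nat) (x : 'I_n -> F) :
  (forall i, x i != 0) ->
  \prod_i (1 - with_inverses x i *: 'X) = quad_prod (fun i => x i + (x i)^-1).
Proof.
move=> x0; rewrite big_split_ord /= -big_split /=; apply: eq_bigr => i _ /=.
rewrite /with_inverses.
case: (fintype.splitP (lshift n i)) => [j /= ij|j /= ij]; last first.
  by have := ltn_ord i; lia.
have <- : i = j by apply: val_inj.
case: (fintype.splitP (rshift n i)) => [k /= ik|k /= ik].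
  by have := ltn_ord k; lia.
have <- : i = k by apply: val_inj => /=; lia.
rewrite -!mul_polyC rmorphD /=.
have E : (x i)%:P * ((x i)^-1)%:P = 1 :> {poly F} by rewrite -rmorphM /= divff.
have -> : 'X^2 = ((x i)%:P * ((x i)^-1)%:P) * 'X^2 :> {poly F} by rewrite E mul1r.
by ring.
Qed.

(** An explicit formula for sz: the symmetric functions that enter are the
    coefficients of \prod_j 1/(1 - z_j t + t^2) with indeterminate z_j. *)
Definition sz_poly (F : fieldType) (n : nat) (lam mu : seq nat) : {mpoly F[n]} :=
  jt_det (zext (inv_coef (quad_prod (fun j : 'I_n => 'X_j)))) lam mu.

Lemma meval_sz_poly (F : fieldType) (n : nat) (lam mu : seq nat)
    (v : 'I_n -> F) :
  (sz_poly F n lam mu).@[v] = jt_det (zext (inv_coef (quad_prod v))) lam mu.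
Proof.
rewrite rmorph_jt_det; apply: eq_jt_det => k.
rewrite rmorph_zext_inv map_quad_prod /=; congr (zext (inv_coef _) k).
by apply: eq_bigr => j _; rewrite mevalXU.
Qed.

Lemma is_sz_sz_poly (F : fieldType) (n : nat) (lam mu : seq nat) :
  is_sz lam mu (sz_poly F n lam mu).
Proof.
split; last first.
  by move=> x x0; rewrite meval_sz_poly meval_skew_schur with_inverses_prod.
apply/issymP => s; rewrite rmorph_jt_det; apply: eq_jt_det => k.
rewrite rmorph_zext_inv map_quad_prod /=; congr (zext (inv_coef _) k).
have E j : msym s ('X_j : {mpoly F[n]}) = 'X_(perm.fun_of_perm s j).
  rewrite msymX; congr 'X_[_]; apply/mnmP => i; rewrite !mnmE.
  by congr nat_of_bool; apply/eqP/eqP => [->|<-]; rewrite ?perm.permKV ?perm.permK.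
rewrite /quad_prod [RHS](reindex_inj (@perm.perm_inj _ s)).
by apply: eq_bigr => j _; rewrite E.
Qed.

(** A root of x^2 = w x - 1 cannot be 0, and dividing by it gives the claim. *)
Lemma joukowski_surj (F : closedFieldType) (w : F) :
  exists x : F, x != 0 /\ x + x^-1 = w.
Proof.
have [x] := solve_monicpoly (fun i => if i == 0%N then -1 else w) (isT : 0 < 2)%N.
rewrite !big_ord_recr big_ord0 /= add0r expr0 mulr1 expr1 => xE.
have x0 : x != 0.
  apply/eqP => x0; move: xE; rewrite x0 expr0n mulr0 addr0 /= => /eqP.
  by rewrite eq_sym oppr_eq0 oner_eq0.
exists x; split=> //; apply: (mulfI x0); rewrite mulrDr mulfV // -expr2 xE; ring.
Qed.

(** Only the existence of a polynomial characterized by [is_sz] matters here: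
    any such polynomial has the same value at a point of the form x + 1/x, and
    all points have this form. *)
Lemma meval_sz (F : closedFieldType) (n : nat) (lam mu : seq nat)
    (z : 'I_n -> F) :
  (sz F n lam mu).@[z] = jt_det (zext (inv_coef (quad_prod z))) lam mu.
Proof.
have [x xE] := fin_all_exists (fun j => joukowski_surj (z j)).
have x0 i : x i != 0 by case: (xE i).
have zE : (fun i => x i + (x i)^-1) =1 z by move=> i; case: (xE i).
have [_ sz_eval] : is_sz lam mu (sz F n lam mu).
  by apply: xgetPex; exists (sz_poly F n lam mu); exact: is_sz_sz_poly.
rewrite -(meval_eq _ zE) sz_eval // meval_skew_schur with_inverses_prod //.
by apply: eq_jt_det => k; congr (zext (inv_coef _) k); apply: eq_bigr => j _; rewrite zE.
Qed.

(** * Coefficients of the symbol *)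

Lemma poly_eq0_nonzero (F : numFieldType) (p : {poly F}) :
  (forall t, t != 0 -> p.[t] = 0) -> p = 0.
Proof.
move=> p0; pose rs : seq F := [seq i.+1%:R | i <- iota 0 (size p)].
apply: (@roots_geq_poly_eq0 _ _ rs); last by rewrite size_map size_iota.
  by apply/allP => _ /mapP[i _ ->]; rewrite /root p0 // pnatr_eq0.
rewrite map_inj_uniq ?iota_uniq // => i j /eqP.
by rewrite eqr_nat => /eqP [].
Qed.

Lemma quad_prod_horner (F : fieldType) (n : nat) (z : 'I_n -> F) (t : F) :
  t != 0 -> (quad_prod z).[t] = t ^+ n * (\prod_(j < n) ('X - (z j)%:P)).[t + t^-1].
Proof.
move=> t0; rewrite !horner_prod -[X in t ^+ X]card_ord -prodr_const -big_split /=.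
apply: eq_bigr => j _; rewrite !hornerE; field.
by [].
Qed.

(** The Laurent polynomial a(t), multiplied by t^n to become a polynomial. The
    index range splits into the negative, zero and positive powers. *)
Lemma symbol_horner (F : numFieldType) (a : int -> F) (n : nat) (t : F) :
  (forall k : int, a (- k) = a k) -> t != 0 ->
  (\poly_(k < n + n.+1) a (k%:Z - n%:Z)).[t]
    = t ^+ n * (cheb_poly a n).[t + t^-1].
Proof.
move=> asym t0; rewrite cheb_polyE // horner_poly.
rewrite -(big_mkord xpredT (fun k => a (k%:Z - n%:Z) * t ^+ k)).
rewrite (big_cat_nat (n := n)) ?leq_addr //=.
rewrite (big_ltn (m := n)); last by rewrite addnS ltnS leq_addr.
rewrite subrr mulrDr addrCA [t ^+ n * a 0]mulrC; congr (_ + _).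
rewrite mulr_sumr; under [RHS]eq_bigr => k _ do rewrite mulrDr.
rewrite big_split /= addrC; congr (_ + _).
  rewrite -{1}[n.+1]add1n big_addn addnS -addSn addnK.
  apply: eq_bigr => k _; rewrite [RHS]mulrCA exprD [t ^+ n * _]mulrC.
  by congr (a _ * _); lia.
rewrite big_nat_rev /= big_add1 /= big_nat [RHS]big_nat.
apply: eq_bigr => k /= kn; rewrite add0n.
rewrite [RHS]mulrCA; congr (a _ * _); first by lia.
by rewrite -[in t ^+ n](subnK kn) exprD mulfK ?expf_neq0.
Qed.

(** The series E is compared with the symbol through its values at nonzero
    points, which determine a polynomial in characteristic 0. The symmetry of a
    turns the index k into -k, so that E generates an upper triangular
    matrix. *)
Lemma symbol_coef (F : numFieldType) (a : int -> F) (n : nat) (z : 'I_n -> F)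
    (k : int) :
  (forall k : int, (n < `|k|)%N -> a k = 0) ->
  (forall k : int, a (- k) = a k) ->
  cheb_poly a n = a n%:Z *: \prod_(j < n) ('X - (z j)%:P) ->
  a k = a n%:Z * zext (nth 0 (quad_prod z)) (n%:Z - k).
Proof.
move=> aout asym chebE.
have polyE : \poly_(k < n + n.+1) a (k%:Z - n%:Z) = a n%:Z *: quad_prod z.
  apply/subr0_eq/poly_eq0_nonzero => t t0; rewrite hornerD hornerN hornerZ.
  by rewrite symbol_horner // quad_prod_horner // chebE hornerZ mulrCA subrr.
have [kn|nk] := lerP k n%:Z; last first.
  by rewrite aout ?zext_neg ?mulr0 //; lia.
have [l lE] : exists l : nat, n%:Z - k = l by exists `|n%:Z - k|%N; lia.
rewrite lE /= -coefZ -polyE coef_poly -asym; case: ifP => [_|/negbT ln].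
  by congr a; lia.
by rewrite aout //; lia.
Qed.

(** * Index lists and partitions *)

Lemma sorted_ltn_gap (s : seq nat) (i j : nat) :
  sorted ltn s -> (i <= j)%N -> (j < size s)%N ->
  (nth 0 s i + (j - i) <= nth 0 s j)%N.
Proof.
move=> ss; elim: j => [|j IH] ij js; first by (have -> : i = 0%N by lia); lia.
have [<-|ne] := eqVneq i j.+1; first by rewrite subnn addn0.
have {}IH := IH ltac:(lia) ltac:(lia).
have := nth_sorted_ltn ss (ltnSn j) js; lia.
Qed.

Lemma nth_subl (s t : seq nat) (i : nat) :
  size s = size t -> (i < size s)%N ->
  nth 0%N (subl s t) i = (nth 0 s i - nth 0 t i)%N.
Proof.
by move=> st is_; rewrite (nth_map (0%N, 0%N)) ?size_zip -?st ?minnn // nth_zip.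
Qed.

Lemma nth_addl (s t : seq nat) (i : nat) :
  size s = size t -> (i < size s)%N ->
  nth 0%N (addl s t) i = (nth 0 s i + nth 0 t i)%N.
Proof.
by move=> st is_; rewrite (nth_map (0%N, 0%N)) ?size_zip -?st ?minnn // nth_zip.
Qed.

Lemma size_subl (s t : seq nat) : size (subl s t) = minn (size s) (size t).
Proof. by rewrite size_map size_zip. Qed.

Lemma size_addl (s t : seq nat) : size (addl s t) = minn (size s) (size t).
Proof. by rewrite size_map size_zip. Qed.

Lemma noninc_default (s : seq nat) (L : nat) :
  (size s <= L)%N ->
  (forall i j, (i <= j)%N -> (j < L)%N -> (nth 0 s j <= nth 0 s i)%N) ->
  noninc s.
Proof.
move=> sL mono i j ij; have [jL|Lj] := ltnP j L; first exact: mono.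
by rewrite nth_default // (leq_trans sL).
Qed.

(** Positions read backwards: F and G list, in increasing order, the numbers
    lam_j - j and mu_k - k shifted by b. The determinant then has entries
    indexed by differences of positions, up to reflection in the
    antidiagonal. *)
Lemma jt_det_beta_rev (R : comNzRingType) (c : int -> R) (lam mu F G : seq nat)
    (L b : nat) :
  (forall k, k < 0 -> c k = 0) -> c 0 = 1 ->
  sorted ltn F -> sorted ltn G -> size F = L -> size G = L ->
  (size lam <= L)%N -> (size mu <= L)%N ->
  (forall j, (j < L)%N -> (nth 0 lam j + b = nth 0 F (L - j.+1) + j)%N) ->
  (forall k, (k < L)%N -> (nth 0 mu k + b = nth 0 G (L - k.+1) + k)%N) ->
  jt_det c lam mu
    = \det (\matrix_(j < L, k < L) c ((nth 0%N F k)%:Z - (nth 0%N G j)%:Z)).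
Proof.
move=> cneg c0 oF oG sF sG slam smu lamE muE.
rewrite (jt_det_full (L := L)) //.
- pose f (j k : nat) := c ((nth 0%N F k)%:Z - (nth 0%N G j)%:Z).
  rewrite -[RHS](det_antitranspose L f); congr determinant.
  apply/matrixP => j k; rewrite !mxE /f; congr c.
  by have := lamE j (ltn_ord j); have := muE k (ltn_ord k); lia.
- apply: (noninc_default slam) => i j ij jL.
  have := @sorted_ltn_gap F (L - j.+1) (L - i.+1) oF ltac:(lia) ltac:(lia).
  by have := lamE _ jL; have := lamE i ltac:(lia); lia.
- apply: (noninc_default smu) => i j ij jL.
  have := @sorted_ltn_gap G (L - j.+1) (L - i.+1) oG ltac:(lia) ltac:(lia).
  by have := muE _ jL; have := muE i ltac:(lia); lia.
Qed.

(** Positions subtracted from a constant: here lam_j - j = b - G_j and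
    mu_k - k = b - F_k, and no reflection is needed. *)
Lemma jt_det_beta (R : comNzRingType) (c : int -> R) (lam mu F G : seq nat)
    (L b : nat) :
  (forall k, k < 0 -> c k = 0) -> c 0 = 1 ->
  sorted ltn F -> sorted ltn G -> size F = L -> size G = L ->
  (size lam <= L)%N -> (size mu <= L)%N ->
  (forall j, (j < L)%N -> (nth 0 lam j + nth 0 G j = b + j)%N) ->
  (forall k, (k < L)%N -> (nth 0 mu k + nth 0 F k = b + k)%N) ->
  jt_det c lam mu
    = \det (\matrix_(j < L, k < L) c ((nth 0%N F k)%:Z - (nth 0%N G j)%:Z)).
Proof.
move=> cneg c0 oF oG sF sG slam smu lamE muE.
rewrite (jt_det_full (L := L)) //.
- congr determinant; apply/matrixP => j k; rewrite !mxE; congr c.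
  by have := lamE j (ltn_ord j); have := muE k (ltn_ord k); lia.
- apply: (noninc_default slam) => i j ij jL.
  have := @sorted_ltn_gap G i j oG ltac:(lia) ltac:(lia).
  by have := lamE _ jL; have := lamE i ltac:(lia); lia.
- apply: (noninc_default smu) => i j ij jL.
  have := @sorted_ltn_gap F i j oF ltac:(lia) ltac:(lia).
  by have := muE _ jL; have := muE i ltac:(lia); lia.
Qed.

Lemma sorted_ltn_bounds (s : seq nat) (d r i : nat) :
  sorted ltn s -> all (fun x => x < r + d)%N s -> size s = d -> (i < d)%N ->
  (i <= nth 0 s i <= r + i)%N.
Proof.
move=> ss sm sd id.
have := @sorted_ltn_gap s 0 i ss ltac:(lia) ltac:(lia).
have := @sorted_ltn_gap s i d.-1 ss ltac:(lia) ltac:(lia).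
have /(allP sm) : nth 0%N s d.-1 \in s by rewrite mem_nth // sd; lia.
lia.
Qed.

Lemma sorted_cat_iota (s : seq nat) (m n : nat) :
  sorted ltn s -> all (fun x => x < m)%N s -> sorted ltn (s ++ iota m n).
Proof.
move=> ss sm; rewrite sorted_pairwise; last exact: ltn_trans.
rewrite pairwise_cat -!sorted_pairwise; try exact: ltn_trans.
rewrite ss iota_ltn_sorted !andbT; apply/allrelP => x y /(allP sm) xm.
by rewrite mem_iota; lia.
Qed.

Lemma sorted_iota_shift (s : seq nat) (n : nat) :
  sorted ltn s -> sorted ltn (iota 0 n ++ map (addn n) s).
Proof.
move=> ss; rewrite sorted_pairwise; last exact: ltn_trans.
rewrite pairwise_cat -!sorted_pairwise; try exact: ltn_trans.
rewrite iota_ltn_sorted /= (@homo_sorted _ _ _ ltn ltn) //; last first.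
  by move=> x y xy; lia.
rewrite andbT; apply/allrelP => x _ + /mapP[y _ ->].
by rewrite mem_iota; lia.
Qed.

Lemma nth_col_list (X : seq nat) (m n d p : nat) :
  size X = d -> (p < n + d)%N ->
  nth 0%N (X ++ iota m n) p = if (p < d)%N then nth 0%N X p else (m + p - d)%N.
Proof.
move=> sX pL; rewrite nth_cat sX; case: ifP => // pd.
by rewrite nth_iota; lia.
Qed.

Lemma nth_row_list (Y : seq nat) (n d p : nat) :
  size Y = d -> (p < n + d)%N ->
  nth 0%N (iota 0 n ++ map (addn n) Y) p
    = if (p < n)%N then p else (n + nth 0 Y (p - n))%N.
Proof.
move=> sY pL; rewrite nth_cat size_iota; case: ifP => pn; first by rewrite nth_iota.
by rewrite (nth_map 0%N) // sY; lia.
Qed.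

(** The positions from r + d on in the column list account for the n parts equal
    to r, and the positions 0..n-1 at the start of the row list for the
    trailing zeros of the inner partition. *)
Lemma jt_det_first (R : comNzRingType) (c : int -> R) (X Y : seq nat)
    (n r d : nat) :
  (forall k, k < 0 -> c k = 0) -> c 0 = 1 ->
  sorted ltn X -> sorted ltn Y -> size X = d -> size Y = d ->
  all (fun x => x < r + d)%N X -> all (fun x => x < r + d)%N Y ->
  jt_det c (nseq n r ++ rev (subl (map succn X) (idl d)))
           (rev (subl (map succn Y) (idl d)))
    = \det (\matrix_(j < n + d, k < n + d)
        c ((nth 0%N (X ++ iota (r + d) n) k)%:Z
           - (nth 0%N (iota 0 n ++ map (addn n) Y) j)%:Z)).
Proof.
move=> cneg c0 oX oY sX sY bX bY.
have size_sub (s : seq nat) : size s = d -> size (subl (map succn s) (idl d)) = d.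
  by move=> ss; rewrite size_subl size_map size_iota ss minnn.
have nth_sub (s : seq nat) i : size s = d -> (i < d)%N ->
    nth 0%N (subl (map succn s) (idl d)) i = (nth 0 s i - i)%N.
  move=> ss id; rewrite nth_subl ?size_map ?size_iota ?ss //.
  by rewrite (nth_map 0%N) ?ss // nth_iota // add1n subSS.
apply: (jt_det_beta_rev (b := (n + d).-1)) => //.
- exact: sorted_cat_iota.
- exact: sorted_iota_shift.
- by rewrite size_cat size_iota sX addnC.
- by rewrite size_cat size_map size_iota sY.
- by rewrite size_cat size_nseq size_rev size_sub.
- by rewrite size_rev size_sub // leq_addl.
- move=> j jL; rewrite (nth_col_list _ sX); last by lia.
  rewrite nth_cat size_nseq nth_nseq; have [jn|nj] := ltnP j n.
    by rewrite ifN; lia.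
  rewrite nth_rev size_sub //; last by lia.
  rewrite nth_sub //; last by lia.
  have := @sorted_ltn_bounds X d r (d - (j - n).+1) oX bX sX ltac:(lia).
  have -> : (n + d - j.+1 = d - (j - n).+1)%N by lia.
  rewrite ifT; lia.
- move=> k kL; rewrite (nth_row_list sY); last by lia.
  have [kd|dk] := ltnP k d; last first.
    by rewrite nth_default ?size_rev ?size_sub // ifT; lia.
  rewrite nth_rev size_sub // nth_sub //; last by lia.
  have := @sorted_ltn_bounds Y d r (d - k.+1) oY bY sY ltac:(lia).
  rewrite ifN; last by lia.
  have -> : (n + d - k.+1 - n = d - k.+1)%N by lia.
  lia.
Qed.

(** Now the positions 0..n-1 of the row list account for the n parts equal to r,
    and the positions from r + d on in the column list for the trailing zeros. *)
Lemma jt_det_second (R : comNzRingType) (c : int -> R) (X Y : seq nat)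
    (n r d : nat) :
  (forall k, k < 0 -> c k = 0) -> c 0 = 1 ->
  sorted ltn X -> sorted ltn Y -> size X = d -> size Y = d ->
  all (fun x => x < r + d)%N X -> all (fun x => x < r + d)%N Y ->
  jt_det c (nseq n r ++ subl (addl (nseq d r) (idl d)) (map succn Y))
           (subl (addl (nseq d r) (idl d)) (map succn X))
    = \det (\matrix_(j < n + d, k < n + d)
        c ((nth 0%N (X ++ iota (r + d) n) k)%:Z
           - (nth 0%N (iota 0 n ++ map (addn n) Y) j)%:Z)).
Proof.
move=> cneg c0 oX oY sX sY bX bY.
have size_add : size (addl (nseq d r) (idl d)) = d.
  by rewrite size_addl size_nseq size_iota minnn.
have size_sub (s : seq nat) : size s = d ->
    size (subl (addl (nseq d r) (idl d)) (map succn s)) = d.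
  by move=> ss; rewrite size_subl size_add size_map ss minnn.
have nth_sub (s : seq nat) i : size s = d -> (i < d)%N ->
    nth 0%N (subl (addl (nseq d r) (idl d)) (map succn s)) i
      = (r + i - nth 0 s i)%N.
  move=> ss id; rewrite nth_subl ?size_add ?size_map ?ss //.
  rewrite nth_addl ?size_nseq ?size_iota // nth_nseq id (nth_map 0%N) ?ss //.
  by rewrite nth_iota // add1n addnS subSS.
apply: (jt_det_beta (b := r)) => //.
- exact: sorted_cat_iota.
- exact: sorted_iota_shift.
- by rewrite size_cat size_iota sX addnC.
- by rewrite size_cat size_map size_iota sY.
- by rewrite size_cat size_nseq size_sub.
- by rewrite size_sub // leq_addl.
- move=> j jL; rewrite (nth_row_list sY) // nth_cat size_nseq nth_nseq.
  have [jn|nj] := ltnP j n; first by [].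
  rewrite nth_sub //; last by lia.
  by have := @sorted_ltn_bounds Y d r (j - n) oY bY sY ltac:(lia); lia.
- move=> k kL; rewrite (nth_col_list _ sX) //.
  have [kd|dk] := ltnP k d; last by rewrite nth_default ?size_sub //; lia.
  by rewrite nth_sub //; have := @sorted_ltn_bounds X d r k oX bX sX kd; lia.
Qed.

(** * Toeplitz minors *)

(** The zero-based counterpart of [idx_compl]. *)
Definition compl0 (m : nat) (s : seq nat) : seq nat :=
  [seq k <- iota 0 m | k \notin s].

Lemma sorted_compl0 (m : nat) (s : seq nat) : sorted ltn (compl0 m s).
Proof. by apply: sorted_filter; [exact: ltn_trans | exact: iota_ltn_sorted]. Qed.

Lemma all_compl0 (m : nat) (s : seq nat) :
  all (fun x => x < m)%N (compl0 m s).
Proof. by apply/allP => x; rewrite mem_filter mem_iota => /and3P[]. Qed.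

Lemma perm_compl0 (m : nat) (s : seq nat) :
  sorted ltn s -> all (fun x => x < m)%N s ->
  perm_eq (s ++ compl0 m s) (iota 0 m).
Proof.
move=> ss /allP sm; have /permPl := perm_filterC (mem s) (iota 0 m).
rewrite (_ : filter (mem s) (iota 0 m) = s) //.
apply: (irr_sorted_eq ltn_trans ltnn) => //.
  by apply: sorted_filter; [exact: ltn_trans | exact: iota_ltn_sorted].
move=> x; rewrite mem_filter mem_iota /= add0n.
by apply: andb_idr => /sm.
Qed.

Lemma size_compl0 (m : nat) (s : seq nat) :
  sorted ltn s -> all (fun x => x < m)%N s ->
  size (compl0 m s) = (m - size s)%N.
Proof.
move=> ss sm; have := perm_size (perm_compl0 ss sm).
by rewrite size_cat size_iota => /(canRL (addKn _)).
Qed.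

Lemma perm_shift_compl0 (m n : nat) (s : seq nat) :
  sorted ltn s -> all (fun x => x < m)%N s ->
  perm_eq (map (addn n) s ++ (iota 0 n ++ map (addn n) (compl0 m s)))
          (iota 0 (n + m)).
Proof.
move=> ss sm; rewrite perm_catCA -map_cat iotaD addnC iotaDl.
by rewrite perm_cat2l perm_map // perm_compl0.
Qed.

(** The columns n + t of the Toeplitz matrix of size m + n generated by E are
    those in which the coefficients of index n + t_j - s_i appear; Jacobi's
    identity passes to the complementary minor of the inverse. *)
Lemma toeplitz_minor (R : comNzRingType) (E : {poly R}) (n m : nat) (s t : seq nat) :
  E`_0 = 1 -> sorted ltn s -> sorted ltn t ->
  all (fun x => x < m)%N s -> all (fun x => x < m)%N t -> size s = size t ->
  \det (\matrix_(i < size s, j < size s)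
          zext (nth 0 E) (n%:Z + (nth 0%N t j)%:Z - (nth 0%N s i)%:Z))
  = (-1) ^+ (size s * n + sumn s + sumn t) *
    \det (\matrix_(i < n + (m - size s), j < n + (m - size s))
       zext (inv_coef E) ((nth 0%N (compl0 m s ++ iota m n) j)%:Z
         - (nth 0%N (iota 0 n ++ map (addn n) (compl0 m t)) i)%:Z)).
Proof.
move=> E0 os ot bs bt st; set r := size s.
pose U (i j : nat) := zext (nth 0 E) (j%:Z - i%:Z).
pose V (i j : nat) := zext (inv_coef E) (j%:Z - i%:Z).
have rm : (r <= m)%N.
  by have := perm_size (perm_compl0 os bs); rewrite size_cat size_iota -/r; lia.
have ME : (r + (n + (m - r)) = m + n)%N by lia.
have pF : perm_eq (s ++ (compl0 m s ++ iota m n)) (iota 0 (r + (n + (m - r)))).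
  by rewrite ME iotaD catA perm_cat2r perm_compl0.
have pG : perm_eq (map (addn n) t ++ (iota 0 n ++ map (addn n) (compl0 m t)))
    (iota 0 (r + (n + (m - r)))).
  by rewrite ME addnC perm_shift_compl0.
have detU M : \det (\matrix_(i < M, j < M) U i j) = 1.
  rewrite (det_lower_unitriangular (p := 0)) ?det_mx00 // => i j _ ji.
  have [->|ij] := eqVneq i j; first by rewrite /U subrr.
  by rewrite /U zext_neg //; lia.
have UV x y : (x < r + (n + (m - r)))%N -> (y < r + (n + (m - r)))%N ->
    \sum_(k < r + (n + (m - r))) U x k * V k y = (x == y)%:R.
  exact: toeplitz_inv.
have oF2 := sorted_cat_iota n (sorted_compl0 m s) (all_compl0 m s).
have oG1 : sorted ltn (map (addn n) t).
  by apply: (@homo_sorted _ _ _ ltn ltn) ot => x y xy; rewrite /= ltn_add2l.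
have oG2 := sorted_iota_shift n (sorted_compl0 m t).
have sG1 : size (map (addn n) t) = r by rewrite size_map.
have := jacobi_complementary_minor (erefl r) sG1 os oF2 oG1 oG2 pF pG UV (detU _).
have -> : sumn (map (addn n) t) = (r * n + sumn t)%N.
  rewrite /r st; elim: (t) => //= x w ->; lia.
have -> : (sumn s + (r * n + sumn t) = r * n + sumn s + sumn t)%N by lia.
move <-; congr determinant; apply/matrixP => i j; rewrite !mxE /U.
by rewrite (nth_map 0%N) -?st //; congr zext; lia.
Qed.

Lemma nth_ord_list (m r : nat) (f : 'I_r -> 'I_m) (i : 'I_r) :
  nth 0%N [seq (f j : nat) | j <- enum 'I_r] i = f i.
Proof. by rewrite (nth_map i) ?size_enum_ord // nth_ord_enum. Qed.

Lemma sorted_ord_list (m r : nat) (f : 'I_r -> 'I_m) :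
  (forall i j : 'I_r, (i < j)%N -> (f i < f j)%N) ->
  sorted ltn [seq (f j : nat) | j <- enum 'I_r].
Proof.
move=> fm; apply: (@homo_sorted _ _ _ (fun i j : 'I_r => i < j)%N ltn) => //.
by have := iota_ltn_sorted 0 r; rewrite -val_enum_ord sorted_map.
Qed.

Lemma all_ord_list (m r : nat) (f : 'I_r -> 'I_m) :
  all (fun x => x < m)%N [seq (f j : nat) | j <- enum 'I_r].
Proof. by apply/allP => _ /mapP[i _ ->]. Qed.

Lemma idx_listE (m r : nat) (f : 'I_r -> 'I_m) :
  idx_list f = map succn [seq (f j : nat) | j <- enum 'I_r].
Proof. by rewrite -map_comp. Qed.

Lemma idx_compl_succ (m : nat) (s : seq nat) :
  idx_compl m (map succn s) = map succn (compl0 m s).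
Proof.
rewrite /idx_compl -[1%N]addn0 iotaDl filter_map; congr map.
by apply: eq_filter => k; rewrite /= add1n mem_map //; exact: succn_inj.
Qed.

Lemma sumn_map_succ (s : seq nat) : sumn (map succn s) = (sumn s + size s)%N.
Proof. by elim: s => //= x s ->; lia. Qed.


Theorem proposition8p1 (R : realType) (n : nat) (a : int -> R[i])
    (z : 'I_n -> R[i]) (m r : nat) (rho sigma : 'I_r -> 'I_m) :
  (1 <= n)%N ->
  (forall k : int, (n < `|k|)%N -> a k = 0) ->
  a n%:Z != 0 ->
  (forall k : int, a (- k) = a k) ->
  cheb_poly a n = a n%:Z *: \prod_(j < n) ('X - (z j)%:P) ->
  (1 <= m)%N -> (r <= m)%N ->
  (forall i j : 'I_r, (i < j)%N -> (rho i < rho j)%N) ->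
  (forall i j : 'I_r, (i < j)%N -> (sigma i < sigma j)%N) ->
  let d := (m - r)%N in
  let xi := idx_compl m (idx_list rho) in
  let eta := idx_compl m (idx_list sigma) in
  let sgn : R[i] :=
    (-1) ^+ (r * n + sumn (idx_list rho) + sumn (idx_list sigma)) in
  \det (mxsub rho sigma (toeplitz a m))
    = sgn * a n%:Z ^+ r *
      (sz R[i] n (nseq n r ++ rev (subl xi (idl d)))
                 (rev (subl eta (idl d)))).@[z]
  /\
  \det (mxsub rho sigma (toeplitz a m))
    = sgn * a n%:Z ^+ r *
      (sz R[i] n (nseq n r ++ subl (addl (nseq d r) (idl d)) eta)
                 (subl (addl (nseq d r) (idl d)) xi)).@[z].
Proof.
move=> _ aout _ asym chebE _ rm rho_mono sigma_mono d xi eta sgn.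
pose s := [seq (rho j : nat) | j <- enum 'I_r].
pose t := [seq (sigma j : nat) | j <- enum 'I_r].
pose E := quad_prod z.
have os : sorted ltn s := sorted_ord_list rho_mono.
have ot : sorted ltn t := sorted_ord_list sigma_mono.
have bs : all (fun x => x < m)%N s := all_ord_list rho.
have bt : all (fun x => x < m)%N t := all_ord_list sigma.
have ss : size s = r by rewrite size_map size_enum_ord.
have st : size t = r by rewrite size_map size_enum_ord.
have xiE : xi = map succn (compl0 m s) by rewrite /xi idx_listE idx_compl_succ.
have etaE : eta = map succn (compl0 m t).
  by rewrite /eta idx_listE idx_compl_succ.
have sgnE : sgn = (-1) ^+ (r * n + sumn s + sumn t).
  rewrite /sgn !idx_listE !sumn_map_succ -/s -/t ss st.
  by rewrite -[LHS]signr_odd -[RHS]signr_odd; congr (_ ^+ _); lia.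
have rd : (r + d = m)%N by rewrite subnKC.
have sX : size (compl0 m s) = d by rewrite size_compl0 ?ss.
have sY : size (compl0 m t) = d by rewrite size_compl0 ?st.
have detE : \det (mxsub rho sigma (toeplitz a m))
    = sgn * a n%:Z ^+ r * \det (\matrix_(i < n + d, j < n + d)
       zext (inv_coef E) ((nth 0%N (compl0 m s ++ iota (r + d) n) j)%:Z
         - (nth 0%N (iota 0 n ++ map (addn n) (compl0 m t)) i)%:Z)).
  have := @toeplitz_minor _ E n m s t (quad_prod_coef0 z) os ot bs bt
    (etrans ss (esym st)).
  rewrite ss -/d -sgnE rd mulrAC => <-; rewrite mulrC -detZ.
  congr determinant; apply/matrixP => i j; rewrite !mxE !nth_ord_list.
  by rewrite (symbol_coef _ aout asym chebE); congr (_ * zext _ _); lia.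
have cneg k : k < 0 -> zext (inv_coef E) k = 0 by exact: zext_neg.
have c0 : zext (inv_coef E) 0 = 1 by exact: inv_coef0.
rewrite !meval_sz xiE etaE -/E.
rewrite jt_det_first ?jt_det_second ?sorted_compl0 ?rd ?all_compl0 //.
by rewrite rd in detE.
Qed.
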